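(* There exist computably enumerable equivalence relations $R$ and $S$ on $\omega$, each with infinitely many equivalence classes, such that the reducibility spectrum $\mathrm{DgSp}_{\Rightarrow}(R,S)$ has no basis.
   Context: For equivalence relations $R,S$ on $\omega$ and a Turing degree $\mathbf{d}$, write $R\leq_{\mathbf{d}} S$ if there is a $\mathbf{d}$-computable function $f:\omega\to\omega$ such that for all $x,y\in\omega$, $x R y \Leftrightarrow f(x) S f(y)$. The reducibility spectrum of $(R,S)$ is $\mathrm{DgSp}_{\Rightarrow}(R,S)=\{\mathbf{d} : R\leq_{\mathbf{d}} S\}$. An equivalence relation $R$ on $\omega$ is computably enumerable (a ceer) if the set of pairs $\{(x,y) : x R y\}$ is c.e. A set $\mathcal{B}$ of Turing degrees is a basis of a set $\mathcal{A}$ of Turing degrees if (1) the elements of $\mathcal{B}$ are pairwise Turing-incomparable, and (2) $\mathcal{A}=\{\mathbf{d} : (\exists \mathbf{b}\in\mathcal{B})(\mathbf{b}\leq\mathbf{d})\}$. *)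

(* Defs.v *)
From Stdlib Require Import Arith List Cantor RelationClasses.
Import ListNotations.

(** Partial recursive functions of one argument relative to an oracle; tuples
    are passed through the Cantor pairing [Cantor.to_nat]. *)

Inductive code : Type :=
| CZero
| CSucc
| CFst
| CSnd
| CPair (f g : code)
| CComp (f g : code)
| CPrec (f g : code)
| CMu (f : code)
| COracle.

Notation "⟨ x , y ⟩" := (Cantor.to_nat (x, y)) (at level 0).

(** Graph of primitive recursion on [n], for partial (relational) data. *)
Fixpoint prec_graph (base : nat -> Prop) (step : nat -> nat -> nat -> Prop)
    (n y : nat) : Prop :=
  match n with
  | 0 => base y
  | S m => exists r, prec_graph base step m r /\ step m r y
  end.

(** [eval O c x y]: on input [x], the program [c] halts with output [y].
    [O] is the graph of the oracle; querying it outside its domain diverges. *)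
Fixpoint eval (O : nat -> nat -> Prop) (c : code) (x y : nat) : Prop :=
  match c with
  | CZero => y = 0
  | CSucc => y = S x
  | CFst => y = fst (Cantor.of_nat x)
  | CSnd => y = snd (Cantor.of_nat x)
  | CPair f g => exists u v, eval O f x u /\ eval O g x v /\ y = ⟨u, v⟩
  | CComp f g => exists u, eval O g x u /\ eval O f u y
  | CPrec f g =>
      let a := fst (Cantor.of_nat x) in
      prec_graph (eval O f a) (fun m r => eval O g ⟨a, ⟨m, r⟩⟩)
        (snd (Cantor.of_nat x)) y
  | CMu f =>
      eval O f ⟨x, y⟩ 0 /\
      forall k, k < y -> exists v, eval O f ⟨x, k⟩ (S v)
  | COracle => O x y
  end.

(** Graph of the characteristic function of [A]. *)
Definition char_graph (A : nat -> Prop) (n v : nat) : Prop :=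
  (A n /\ v = 1) \/ (~ A n /\ v = 0).

Definition computable_in (A : nat -> Prop) (f : nat -> nat) : Prop :=
  exists c, forall x, eval (char_graph A) c x (f x).

Definition turing_le (A B : nat -> Prop) : Prop :=
  exists c, forall n v, char_graph A n v -> eval (char_graph B) c n v.

Definition turing_equiv (A B : nat -> Prop) : Prop :=
  turing_le A B /\ turing_le B A.

(** With the nowhere defined oracle, [eval] gives exactly the (unrelativized)
    partial computable functions. *)
Definition eval0 : code -> nat -> nat -> Prop := eval (fun _ _ => False).

Definition ce (P : nat -> Prop) : Prop :=
  exists c, forall n, P n <-> exists v, eval0 c n v.

(** Turing degrees are the equivalence classes of [turing_equiv]. *)
Record degree : Type := Degree {
  deg_mem :> (nat -> Prop) -> Prop;
  deg_class : exists A, forall B, deg_mem B <-> turing_equiv A B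
}.

Definition deg_le (d e : degree) : Prop :=
  exists A B, d A /\ e B /\ turing_le A B.

Definition deg_computable (d : degree) (f : nat -> nat) : Prop :=
  exists A, d A /\ computable_in A f.

Definition reducible (d : degree) (R S : nat -> nat -> Prop) : Prop :=
  exists f : nat -> nat,
    deg_computable d f /\ forall x y, R x y <-> S (f x) (f y).

Definition DgSp (R S : nat -> nat -> Prop) : degree -> Prop :=
  fun d => reducible d R S.

Definition is_basis (B A : degree -> Prop) : Prop :=
  (forall b c, B b -> B c -> b <> c -> ~ deg_le b c /\ ~ deg_le c b) /\
  (forall d, A d <-> exists b, B b /\ deg_le b d).

Definition ceer (R : nat -> nat -> Prop) : Prop :=
  Equivalence R /\
  ce (fun n => R (fst (Cantor.of_nat n)) (snd (Cantor.of_nat n))).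

(** No finite list contains all the classes [R x = {y | R x y}]. *)
Definition infinitely_many_classes (R : nat -> nat -> Prop) : Prop :=
  ~ exists l : list (nat -> Prop),
      forall x, exists C, In C l /\ forall y, C y <-> R x y.

(* Main.v *)
(** Let [R] be equality and let [S] collapse all binary strings that err about a fixed
    universal pair [K0], [K1] of disjoint c.e. sets (the programs with output 0, resp. 1),
    and nothing else.  A reduction from [R] to [S] enumerates infinitely many correct
    strings, and these need not cohere: bit [i] of any long enough correct string separates
    at [i].  So the spectrum consists of the degrees computing a separator of [K0] and [K1].

    A separator [z] computes a member of every nonempty Pi^0_1 class of Cantor space, since it
    can choose, for a string with an extension in the class, a child that has one.  Apply this
    to the class of joins of a separator [x] with a set [y] that disagrees on the diagonal with
    every program using the oracle [x].  Then [y], hence [z], is not computable from [x], so no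
    degree of the spectrum is minimal in it, whereas the elements of a basis would be. *)

Require Import Defs.
From Stdlib Require Import Arith Lia List Cantor RelationClasses Classical ClassicalEpsilon FinFun.
Import ListNotations.

(** * Pairing and projections *)

Definition pr (a b : nat) : nat := ⟨a, b⟩.
Definition p1 (n : nat) : nat := fst (Cantor.of_nat n).
Definition p2 (n : nat) : nat := snd (Cantor.of_nat n).

Lemma p1_pr a b : p1 (pr a b) = a.
Proof. unfold p1, pr. now rewrite Cantor.cancel_of_to. Qed.

Lemma p2_pr a b : p2 (pr a b) = b.
Proof. unfold p2, pr. now rewrite Cantor.cancel_of_to. Qed.

Lemma pr_p12 n : pr (p1 n) (p2 n) = n.
Proof.
  unfold pr, p1, p2. rewrite <- surjective_pairing. apply Cantor.cancel_to_of.
Qed.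

#[global] Opaque pr p1 p2.

(** * Evaluation *)

Lemma eval_pair O f g x u v :
  eval O f x u -> eval O g x v -> eval O (CPair f g) x (pr u v).
Proof. intros Hf Hg. exists u, v. auto. Qed.

Lemma eval_prec O f g x y :
  eval O (CPrec f g) x y <->
  prec_graph (eval O f (p1 x)) (fun m r => eval O g (pr (p1 x) (pr m r))) (p2 x) y.
Proof. reflexivity. Qed.

Lemma eval_functional O c :
  (forall q a a', O q a -> O q a' -> a = a') ->
  forall x y y', eval O c x y -> eval O c x y' -> y = y'.
Proof.
  intros HO. induction c as [| | | |f IHf g IHg|f IHf g IHg|f IHf g IHg|f IHf|];
    intros x y y' H H'; try (simpl in H, H'; congruence).
  - destruct H as (u & v & Hu & Hv & ->), H' as (u' & v' & Hu' & Hv' & ->).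
    now rewrite (IHf _ _ _ Hu Hu'), (IHg _ _ _ Hv Hv').
  - destruct H as (u & Hu & Hv), H' as (u' & Hu' & Hv').
    rewrite <- (IHg _ _ _ Hu Hu') in Hv'. eauto.
  - rewrite eval_prec in H, H'. revert y y' H H'.
    induction (p2 x) as [|n IH]; simpl; intros y y' H H'; [eauto|].
    destruct H as (r & Hr & Hs), H' as (r' & Hr' & Hs').
    rewrite <- (IH _ _ Hr Hr') in Hs'. eauto.
  - destruct H as [H Hlt], H' as [H' Hlt'].
    destruct (Nat.lt_trichotomy y y') as [L|[L|L]]; [|exact L|].
    + destruct (Hlt' _ L) as [v Hv]. discriminate (IHf _ _ _ H Hv).
    + destruct (Hlt _ L) as [v Hv]. discriminate (IHf _ _ _ H' Hv).
  - eauto.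
Qed.

Fixpoint subst_oracle (d c : code) : code :=
  match c with
  | CPair f g => CPair (subst_oracle d f) (subst_oracle d g)
  | CComp f g => CComp (subst_oracle d f) (subst_oracle d g)
  | CPrec f g => CPrec (subst_oracle d f) (subst_oracle d g)
  | CMu f => CMu (subst_oracle d f)
  | COracle => d
  | _ => c
  end.

(** Evaluation uses the oracle only positively: even minimization asks for halting nonzero values
    below the result, not for the absence of a zero. So it is enough that [d] gives every answer
    that [O] gives. *)
Lemma eval_subst_oracle (O O' : nat -> nat -> Prop) d c :
  (forall q a, O q a -> eval O' d q a) ->
  forall x y, eval O c x y -> eval O' (subst_oracle d c) x y.
Proof.
  intros HO. induction c as [| | | |f IHf g IHg|f IHf g IHg|f IHf g IHg|f IHf|];
    intros x y H; simpl; try exact H.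
  - destruct H as (u & v & Hu & Hv & E). exists u, v. auto.
  - destruct H as (u & Hu & Hv). exists u. auto.
  - change (eval O' (CPrec (subst_oracle d f) (subst_oracle d g)) x y).
    rewrite eval_prec in H |- *. revert y H.
    induction (p2 x) as [|n IH]; simpl; intros y H; [auto|].
    destruct H as (r & Hr & Hs). exists r. auto.
  - destruct H as [H Hlt]. split; [auto|].
    intros k Hk. destruct (Hlt k Hk) as [v Hv]. exists v. auto.
  - apply HO, H.
Qed.

Lemma turing_le_trans A B C : turing_le A B -> turing_le B C -> turing_le A C.
Proof.
  intros [c Hc] [d Hd]. exists (subst_oracle d c). intros n v Hn.
  eapply eval_subst_oracle; [exact Hd | auto].
Qed.

Lemma turing_le_refl A : turing_le A A.
Proof. exists COracle. auto. Qed.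

(** * Closure properties of total computable functions *)

(** The oracle is an arbitrary graph, so that the closure lemmas serve both computability from a set
    and, with the empty graph, plain computability. *)
Definition rel (O : nat -> nat -> Prop) (f : nat -> nat) : Prop :=
  exists c, forall x, eval O c x (f x).

Lemma computable_in_trans A B f :
  computable_in A f -> turing_le A B -> computable_in B f.
Proof.
  intros [c Hc] [d Hd]. exists (subst_oracle d c). intros x.
  eapply eval_subst_oracle; [exact Hd | auto].
Qed.

Definition ifz (n a b : nat) : nat := match n with 0 => a | S _ => b end.

Section Closure.
Variable O : nat -> nat -> Prop.
Local Notation rel := (rel O).

Lemma rel_ext f g : (forall x, f x = g x) -> rel f -> rel g.
Proof. intros E [c Hc]. exists c. intros x. rewrite <- E. auto. Qed.

Lemma eval_id x : eval O (CPair CFst CSnd) x x.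
Proof.
  pose proof (eval_pair O CFst CSnd x (p1 x) (p2 x) eq_refl eq_refl) as H.
  now rewrite pr_p12 in H.
Qed.

Lemma rel_id : rel (fun x => x).
Proof. exists (CPair CFst CSnd). apply eval_id. Qed.

Lemma rel_comp f g : rel f -> rel g -> rel (fun x => f (g x)).
Proof.
  intros [c Hc] [d Hd]. exists (CComp c d). intros x. exists (g x). auto.
Qed.

Lemma rel_pr f g : rel f -> rel g -> rel (fun x => pr (f x) (g x)).
Proof.
  intros [c Hc] [d Hd]. exists (CPair c d). intros x. now apply eval_pair.
Qed.

Lemma rel_p1 f : rel f -> rel (fun x => p1 (f x)).
Proof. apply (rel_comp p1). exists CFst. reflexivity. Qed.

Lemma rel_p2 f : rel f -> rel (fun x => p2 (f x)).
Proof. apply (rel_comp p2). exists CSnd. reflexivity. Qed.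

Lemma rel_S f : rel f -> rel (fun x => S (f x)).
Proof. apply (rel_comp S). exists CSucc. reflexivity. Qed.

Lemma rel_const n : rel (fun _ => n).
Proof.
  induction n; [exists CZero; reflexivity | now apply rel_S].
Qed.

(** The whole input [z] is passed as the parameter of [CPrec]; the step function is therefore read
    off the packed triple of [z], the counter and the previous value. *)
Lemma rel_rec a s n :
  rel a -> rel n -> rel (fun w => s (p1 w) (p1 (p2 w)) (p2 (p2 w))) ->
  rel (fun z => nat_rect (fun _ => nat) (a z) (fun m r => s z m r) (n z)).
Proof.
  intros [ca Ha] [cn Hn] [cs Hs].
  exists (CComp (CPrec ca cs) (CPair (CPair CFst CSnd) cn)). intros z.
  exists (pr z (n z)). split; [apply eval_pair; auto using eval_id|].
  rewrite eval_prec, p1_pr, p2_pr. induction (n z) as [|m IH]; simpl; [auto|].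
  eexists. split; [exact IH|].
  specialize (Hs (pr z (pr m (nat_rect (fun _ => nat) (a z) (fun m r => s z m r) m)))).
  now rewrite !p2_pr, !p1_pr in Hs.
Qed.

Lemma rel_ifz n a b : rel n -> rel a -> rel b -> rel (fun z => ifz (n z) (a z) (b z)).
Proof.
  intros Hn Ha Hb.
  apply rel_ext with
    (fun z => nat_rect (fun _ => nat) (a z) (fun _ _ => b z) (n z)).
  - intros z. now destruct (n z).
  - apply (rel_rec a (fun z _ _ => b z)); auto. apply (rel_comp b); auto using rel_p1, rel_id.
Qed.

Lemma rel_pred f : rel f -> rel (fun z => pred (f z)).
Proof.
  intros Hf.
  apply rel_ext with (fun z => nat_rect (fun _ => nat) 0 (fun m _ => m) (f z)).
  - intros z. now destruct (f z).
  - apply (rel_rec (fun _ => 0) (fun _ m _ => m));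
      auto using rel_const, rel_p1, rel_p2, rel_id.
Qed.

Lemma rel_add f g : rel f -> rel g -> rel (fun z => f z + g z).
Proof.
  intros Hf Hg.
  apply rel_ext with (fun z => nat_rect (fun _ => nat) (g z) (fun _ r => S r) (f z)).
  - intros z. induction (f z); simpl; congruence.
  - apply (rel_rec g (fun _ _ r => S r)); auto using rel_S, rel_p2, rel_id.
Qed.

Lemma rel_sub f g : rel f -> rel g -> rel (fun z => f z - g z).
Proof.
  intros Hf Hg.
  apply rel_ext with (fun z => nat_rect (fun _ => nat) (f z) (fun _ r => pred r) (g z)).
  - intros z. induction (g z) as [|m IH]; simpl; [lia|]. rewrite IH. lia.
  - apply (rel_rec f (fun _ _ r => pred r)); auto using rel_pred, rel_p2, rel_id.
Qed.

Lemma rel_pow2 f : rel f -> rel (fun z => 2 ^ f z).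
Proof.
  intros Hf.
  apply rel_ext with (fun z => nat_rect (fun _ => nat) 1 (fun _ r => r + r) (f z)).
  - intros z. induction (f z) as [|m IH]; [reflexivity|].
    cbn [nat_rect]. rewrite IH, Nat.pow_succ_r'. lia.
  - apply (rel_rec (fun _ => 1) (fun _ _ r => r + r));
      auto using rel_const, rel_add, rel_p2, rel_id.
Qed.

Definition relb (P : nat -> bool) : Prop := rel (fun z => Nat.b2n (P z)).

Lemma relb_ext P Q : (forall z, P z = Q z) -> relb P -> relb Q.
Proof. intros E. apply rel_ext. intros z. now rewrite E. Qed.

Lemma rel_if P f g : relb P -> rel f -> rel g -> rel (fun z => if P z then f z else g z).
Proof.
  intros HP Hf Hg. apply rel_ext with (fun z => ifz (Nat.b2n (P z)) (g z) (f z)).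
  - intros z. now destruct (P z).
  - now apply rel_ifz.
Qed.

Lemma relb_if P Q Q' :
  relb P -> relb Q -> relb Q' -> relb (fun z => if P z then Q z else Q' z).
Proof.
  intros HP HQ HQ'.
  apply rel_ext with (fun z => if P z then Nat.b2n (Q z) else Nat.b2n (Q' z)).
  - intros z. now destruct (P z).
  - now apply rel_if.
Qed.

Lemma relb_const b : relb (fun _ => b).
Proof. apply (rel_const (Nat.b2n b)). Qed.

Lemma relb_neg P : relb P -> relb (fun z => negb (P z)).
Proof. intros HP. apply (relb_if P (fun _ => false) (fun _ => true)); auto using relb_const. Qed.

Lemma relb_and P Q : relb P -> relb Q -> relb (fun z => P z && Q z)%bool.
Proof. intros HP HQ. apply (relb_if P Q (fun _ => false)); auto using relb_const. Qed.

Lemma relb_or P Q : relb P -> relb Q -> relb (fun z => P z || Q z)%bool.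
Proof. intros HP HQ. apply (relb_if P (fun _ => true) Q); auto using relb_const. Qed.

Lemma relb_xor P Q : relb P -> relb Q -> relb (fun z => xorb (P z) (Q z)).
Proof.
  intros HP HQ. apply relb_ext with (fun z => if P z then negb (Q z) else Q z).
  - intros z. now destruct (P z), (Q z).
  - apply relb_if; auto using relb_neg.
Qed.

Lemma relb_leb f g : rel f -> rel g -> relb (fun z => f z <=? g z).
Proof.
  intros Hf Hg. apply rel_ext with (fun z => ifz (f z - g z) 1 0).
  - intros z. destruct (Nat.leb_spec (f z) (g z)) as [H|H].
    + now replace (f z - g z) with 0 by lia.
    + destruct (f z - g z) eqn:E; [lia|reflexivity].
  - apply rel_ifz; auto using rel_sub, rel_const.
Qed.

Lemma relb_ltb f g : rel f -> rel g -> relb (fun z => f z <? g z).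
Proof. intros Hf Hg. apply (relb_leb (fun z => S (f z))); auto using rel_S. Qed.

Lemma relb_eqb f g : rel f -> rel g -> relb (fun z => f z =? g z).
Proof.
  intros Hf Hg. apply relb_ext with (fun z => (f z <=? g z) && (g z <=? f z))%bool.
  - intros z. destruct (Nat.leb_spec (f z) (g z)), (Nat.leb_spec (g z) (f z)),
      (Nat.eqb_spec (f z) (g z)); simpl; lia || reflexivity.
  - auto using relb_and, relb_leb.
Qed.

End Closure.

(** * Bounded quantification and binary digits *)

Definition exlt (n : nat) (P : nat -> bool) : bool :=
  nat_rect (fun _ => bool) false (fun k r => P k || r)%bool n.

Lemma exlt_spec n P : exlt n P = true <-> exists k, k < n /\ P k = true.
Proof.
  induction n as [|n IH]; simpl.
  - split; [discriminate|]. intros (k & H & _). lia.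
  - rewrite Bool.orb_true_iff. unfold exlt in IH. rewrite IH. split.
    + intros [H|(k & Hk & H)]; [exists n; auto | exists k; auto with arith].
    + intros (k & Hk & H). destruct (Nat.eq_dec k n) as [->|]; [auto|].
      right. exists k. split; [lia|auto].
Qed.

Lemma relb_exlt O n P :
  rel O n -> relb O (fun w => P (p1 w) (p2 w)) -> relb O (fun z => exlt (n z) (P z)).
Proof.
  intros Hn HP.
  apply rel_ext with (fun z => nat_rect (fun _ => nat) 0
    (fun k r => ifz (Nat.b2n (P z k)) r 1) (n z)).
  - intros z. induction (n z) as [|k IH]; [reflexivity|].
    simpl. rewrite IH. unfold exlt. now destruct (P z k).
  - apply (rel_rec O (fun _ => 0) (fun z k r => ifz (Nat.b2n (P z k)) r 1));
      auto using rel_const.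
    apply rel_ifz; auto using rel_const, rel_p2, rel_id.
    apply (rel_ext O (fun w => Nat.b2n
      (P (p1 (pr (p1 w) (p1 (p2 w)))) (p2 (pr (p1 w) (p1 (p2 w))))))).
    + intros w. now rewrite p1_pr, p2_pr.
    + apply (rel_comp O (fun w => Nat.b2n (P (p1 w) (p2 w))));
      auto using rel_pr, rel_p1, rel_p2, rel_id.
Qed.

Lemma relb_testbit O f g :
  rel O f -> rel O g -> relb O (fun z => Nat.testbit (f z) (g z)).
Proof.
  intros Hf Hg.
  assert (Hodd : forall h, rel O h -> relb O (fun z => Nat.odd (h z))).
  { intros h Hh. apply rel_ext with
      (fun z => nat_rect (fun _ => nat) 0 (fun _ r => 1 - r) (h z)).
    - intros z. induction (h z) as [|m IH]; [reflexivity|].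
      cbn [nat_rect]. rewrite IH, Nat.odd_succ, <- Nat.negb_odd.
      now destruct (Nat.odd m).
    - apply (rel_rec O (fun _ => 0) (fun _ _ r => 1 - r));
        auto using rel_const, rel_sub, rel_p2, rel_id. }
  (* Passing from [m] to [S m] raises the half by one exactly when [m] is odd. *)
  assert (Hdiv2 : forall h, rel O h -> rel O (fun z => Nat.div2 (h z))).
  { intros h Hh. apply rel_ext with
      (fun z => nat_rect (fun _ => nat) 0 (fun m r => r + Nat.b2n (Nat.odd m)) (h z)).
    - intros z. induction (h z) as [|m IH]; [reflexivity|].
      cbn [nat_rect]. rewrite IH.
      pose proof (Nat.div2_odd m). pose proof (Nat.div2_odd (S m)) as H1.
      rewrite Nat.odd_succ, <- Nat.negb_odd in H1.
      destruct (Nat.odd m); simpl Nat.b2n in *; lia.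
    - apply (rel_rec O (fun _ => 0) (fun _ m r => r + Nat.b2n (Nat.odd m)));
        auto using rel_const.
      apply rel_add; auto using rel_p2, rel_id.
      apply (Hodd (fun w => p1 (p2 w))); auto using rel_p1, rel_p2, rel_id. }
  (* Bit [g z] is the parity left after [g z] halvings. *)
  apply relb_ext with
    (fun z => Nat.odd (nat_rect (fun _ => nat) (f z) (fun _ r => Nat.div2 r) (g z))).
  - intros z. generalize (f z) as a. induction (g z) as [|m IH]; intros a; [reflexivity|].
    simpl Nat.testbit. rewrite <- IH. f_equal. clear.
    induction m as [|m IH]; [reflexivity|]. simpl in *. now rewrite IH.
  - apply Hodd. apply (rel_rec O f (fun _ _ r => Nat.div2 r)); auto.
    apply Hdiv2; auto using rel_p2, rel_id.
Qed.

(** * A universal machine *)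

Fixpoint enc (c : code) : nat :=
  match c with
  | CZero => pr 1 0
  | CSucc => pr 2 0
  | CFst => pr 3 0
  | CSnd => pr 4 0
  | COracle => pr 5 0
  | CPair f g => pr 6 (pr (enc f) (enc g))
  | CComp f g => pr 7 (pr (enc f) (enc g))
  | CPrec f g => pr 8 (pr (enc f) (enc g))
  | CMu f => pr 9 (enc f)
  end.

Fixpoint select (t : nat) (l : list nat) (d : nat) : nat :=
  match l with
  | nil => d
  | a :: l => ifz t a (select (pred t) l d)
  end.

(* A state is [pr k v] with [k] a stack of instructions and [v] the current value.  The
   empty stack is 0 = [pr 0 0], so that its "top instruction" has tag 0 and halts.  Tags 1-9
   are the codes, 10-13 are the continuations of [CPair] (two), [CPrec] and [CMu].  An oracle
   answer [a] is represented by [S a], and [0] blocks the machine. *)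
Definition step (orc : nat -> nat) (st : nat) : nat :=
  let v := p2 st in
  let t := p1 (p1 (p1 st)) in
  let p := p2 (p1 (p1 st)) in
  let k := p2 (p1 st) in
  select t
    [ st;
      pr k 0;
      pr k (S v);
      pr k (p1 v);
      pr k (p2 v);
      ifz (orc v) st (pr k (pred (orc v)));
      pr (pr (p1 p) (pr (pr 10 (pr (p2 p) v)) k)) v;
      pr (pr (p2 p) (pr (p1 p) k)) v;
      pr (pr (p1 p) (pr (pr 12 (pr (p2 p) (pr (p1 v) (pr 0 (p2 v))))) k)) (p1 v);
      pr (pr p (pr (pr 13 (pr p (pr v 0))) k)) (pr v 0);
      pr (pr (p1 p) (pr (pr 11 v) k)) (p2 p);
      pr k (pr p v);
      (let g := p1 p in let a := p1 (p2 p) in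
       let m := p1 (p2 (p2 p)) in let n := p2 (p2 (p2 p)) in
       ifz (n - m) (pr k v)
         (pr (pr g (pr (pr 12 (pr g (pr a (pr (S m) n)))) k)) (pr a (pr m v))));
      (let f := p1 p in let x := p1 (p2 p) in let n := p2 (p2 p) in
       ifz v (pr k n) (pr (pr f (pr (pr 13 (pr f (pr x (S n)))) k)) (pr x (S n)))) ]
    st.

Fixpoint run (n : nat) (orc : nat -> nat) (st : nat) : nat :=
  match n with
  | 0 => st
  | S n => run n orc (step orc st)
  end.

Lemma run_add n m orc st : run (n + m) orc st = run m orc (run n orc st).
Proof. revert st. induction n; simpl; auto. Qed.

Lemma step_halted orc v : step orc (pr 0 v) = pr 0 v.
Proof. unfold step. rewrite !p1_pr. reflexivity. Qed.

Lemma run_halted n orc v : run n orc (pr 0 v) = pr 0 v.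
Proof. induction n; simpl; [|rewrite step_halted]; auto. Qed.

Lemma run_stable n m orc st v : n <= m -> run n orc st = pr 0 v -> run m orc st = pr 0 v.
Proof.
  intros L H. replace m with (n + (m - n)) by lia. now rewrite run_add, H, run_halted.
Qed.

Lemma run_det n m orc st v w : run n orc st = pr 0 v -> run m orc st = pr 0 w -> v = w.
Proof.
  intros H H'. apply (run_stable _ (n + m)) in H, H'; try lia.
  rewrite H in H'. now rewrite <- (p2_pr 0 v), H', p2_pr.
Qed.

Definition answers (O : nat -> nat -> Prop) (b : nat) (orc : nat -> nat) : Prop :=
  forall q a, q < b -> O q a -> orc q = S a.

(** The number of steps and the bound on the queries do not depend on the oracle function, which is
    the use principle needed for truncated oracles. Quantifying over the stack [k] lets a run take
    place on top of pending continuations. *)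
Definition computes O (s : nat -> nat) (s' : nat -> nat) : Prop :=
  exists n b, forall orc k, answers O b orc -> run n orc (s k) = s' k.

Lemma computes_trans O s s' s'' : computes O s s' -> computes O s' s'' -> computes O s s''.
Proof.
  intros (n & b & H) (n' & b' & H'). exists (n + n'), (b + b'). intros orc k A.
  rewrite run_add, H, H'; [reflexivity| |]; intros q a L; apply A; lia.
Qed.

Lemma computes_step O s s' : (forall orc k, step orc (s k) = s' k) -> computes O s s'.
Proof. intros H. exists 1, 0. intros orc k _. apply H. Qed.


Lemma computes_stack O s s' F :
  computes O s s' -> computes O (fun k => s (F k)) (fun k => s' (F k)).
Proof. intros (n & b & H). exists n, b. auto. Qed.

Ltac step_tac :=
  unfold step; cbn [enc]; repeat (rewrite p1_pr || rewrite p2_pr); cbn [select ifz pred].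

Lemma computes_eval O c x y :
  eval O c x y ->
  computes O (fun k => pr (pr (enc c) k) x) (fun k => pr k y).
Proof.
  revert x y. induction c as [| | | |f IHf g IHg|f IHf g IHg|f IHf g IHg|f IHf|];
    intros x y H.
  1-4: apply computes_step; simpl in H; subst y; intros; step_tac; reflexivity.
  - destruct H as (u & v & Hu & Hv & ->).
    apply computes_trans with (fun k => pr (pr (enc f) (pr (pr 10 (pr (enc g) x)) k)) x);
      [apply computes_step; intros; step_tac; reflexivity|].
    eapply computes_trans; [exact (computes_stack _ _ _ _ (IHf _ _ Hu))|].
    apply computes_trans with (fun k => pr (pr (enc g) (pr (pr 11 u) k)) x);
      [apply computes_step; intros; step_tac; reflexivity|].
    eapply computes_trans; [exact (computes_stack _ _ _ _ (IHg _ _ Hv))|].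
    apply computes_step; intros; step_tac; reflexivity.
  - destruct H as (u & Hu & Hv).
    apply computes_trans with (fun k => pr (pr (enc g) (pr (enc f) k)) x);
      [apply computes_step; intros; step_tac; reflexivity|].
    eapply computes_trans; [exact (computes_stack _ _ _ _ (IHg _ _ Hu))|].
    exact (IHf _ _ Hv).
  - rewrite eval_prec in H. set (a := p1 x) in *.
    (* Loop invariant: after [m] rounds the machine is about to resume continuation 12 with counter
       [m], limit [n] and current value [r]. *)
    assert (L : forall m n r, m <= n ->
      prec_graph (eval O f a) (fun m r => eval O g (pr a (pr m r))) m r ->
      computes O (fun k => pr (pr (enc (CPrec f g)) k) (pr a n))
        (fun k => pr (pr (pr 12 (pr (enc g) (pr a (pr m n)))) k) r)).
    { induction m as [|m IH]; intros n r Hm Hr.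
      - apply computes_trans with (fun k =>
          pr (pr (enc f) (pr (pr 12 (pr (enc g) (pr a (pr 0 n)))) k)) a).
        + apply computes_step. intros; step_tac. reflexivity.
        + exact (computes_stack _ _ _ _ (IHf _ _ Hr)).
      - destruct Hr as (r' & Hr' & Hs).
        eapply computes_trans; [apply (IH n r'); [lia|exact Hr']|].
        apply computes_trans with (fun k =>
          pr (pr (enc g) (pr (pr 12 (pr (enc g) (pr a (pr (S m) n)))) k)) (pr a (pr m r'))).
        + apply computes_step. intros; step_tac.
          replace (n - m) with (S (n - S m)) by lia. cbn [ifz]. reflexivity.
        + exact (computes_stack _ _ _ _ (IHg _ _ Hs)). }
    rewrite <- (pr_p12 x). fold a.
    eapply computes_trans; [exact (L (p2 x) (p2 x) y (le_n _) H)|].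
    apply computes_step. intros; step_tac. now rewrite Nat.sub_diag.
  - destruct H as [H Hlt].
    (* Loop invariant: the machine is about to resume continuation 13 after testing [n]. The tested
       value [v] is left general, being positive below [y] and zero at [y]. *)
    assert (L : forall n v, n <= y -> eval O f (pr x n) v ->
      computes O (fun k => pr (pr (enc (CMu f)) k) x)
        (fun k => pr (pr (pr 13 (pr (enc f) (pr x n))) k) v)).
    { induction n as [|n IH]; intros v Hn Hv.
      - apply computes_trans with (fun k =>
          pr (pr (enc f) (pr (pr 13 (pr (enc f) (pr x 0))) k)) (pr x 0)).
        + apply computes_step. intros; step_tac. reflexivity.
        + exact (computes_stack _ _ _ _ (IHf _ _ Hv)).
      - destruct (Hlt n) as [w Hw]; [lia|].
        eapply computes_trans; [apply (IH (S w)); [lia|exact Hw]|].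
        apply computes_trans with (fun k =>
          pr (pr (enc f) (pr (pr 13 (pr (enc f) (pr x (S n)))) k)) (pr x (S n))).
        + apply computes_step. intros; step_tac. reflexivity.
        + exact (computes_stack _ _ _ _ (IHf _ _ Hv)). }
    eapply computes_trans; [exact (L y 0 (le_n _) H)|].
    apply computes_step. intros; step_tac; reflexivity.
  - exists 1, (S x). intros orc k A. cbn [run]. step_tac.
    now rewrite (A x y (Nat.lt_succ_diag_r x) H).
Qed.

(* More oracle answers do not change a halting run, since a blocked machine never halts. *)
Lemma run_mono orc orc' n st v :
  (forall q a, orc q = S a -> orc' q = S a) ->
  run n orc st = pr 0 v -> run n orc' st = pr 0 v.
Proof.
  intros A. revert st. induction n as [|n IH]; intros st H; [exact H|].
  cbn [run] in *.
  assert (D : step orc' st = step orc st \/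
    (step orc st = st /\ p1 (p1 (p1 st)) = 5)).
  { unfold step. destruct (p1 (p1 (p1 st))) as [|[|[|[|[|[|t]]]]]]; try (left; reflexivity).
    cbn [select ifz pred]. destruct (orc (p2 st)) as [|a] eqn:E; [now right|].
    left. now rewrite (A _ _ E). }
  destruct D as [D|[D T]].
  - rewrite D. auto.
  - rewrite D in H.
    assert (E : forall m, run m orc st = st)
      by (induction m as [|m IHm]; cbn [run]; [|rewrite D]; auto).
    rewrite E in H. rewrite H, p1_pr in T. discriminate T.
Qed.

Lemma run_ext orc orc' n st : (forall q, orc q = orc' q) -> run n orc st = run n orc' st.
Proof.
  intros A. revert st. induction n as [|n IH]; intros st; cbn [run]; [auto|].
  rewrite IH. f_equal. unfold step. now rewrite A.
Qed.

Definition no_oracle (_ : nat) : nat := 0.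
Definition set_oracle (X : nat -> bool) (q : nat) : nat := S (Nat.b2n (X q)).

(** Queries go to the even bits, the first half of a join. Cutting at [b] leaves finitely many
    answers, so a number can stand for [U] and the runs become computable functions of it. *)
Definition cut_oracle (b : nat) (U : nat -> bool) (q : nat) : nat :=
  if q <? b then S (Nat.b2n (U (q + q))) else 0.

Lemma rel_select O t d l :
  rel O t -> rel O d -> Forall (rel O) l ->
  rel O (fun z => select (t z) (map (fun f => f z) l) (d z)).
Proof.
  intros Ht Hd Hl. revert t Ht.
  induction Hl as [|f l Hf _ IH]; intros t Ht; cbn [select map]; [auto|].
  apply rel_ifz; auto. apply (IH (fun z => pred (t z))). now apply rel_pred.
Qed.

Create HintDb rel discriminated.
#[local] Hint Resolve rel_id rel_const rel_pr rel_p1 rel_p2 rel_S rel_ifz rel_pred rel_add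
  rel_sub rel_pow2 relb_const relb_neg relb_and relb_or relb_xor relb_leb relb_ltb relb_eqb
  relb_testbit relb_exlt : rel.

Lemma rel_step_cut O b u st :
  rel O b -> rel O u -> rel O st ->
  rel O (fun z => step (cut_oracle (b z) (Nat.testbit (u z))) (st z)).
Proof.
  intros Hb Hu Hs. unfold step.
  assert (Ho : rel O (fun z => cut_oracle (b z) (Nat.testbit (u z)) (p2 (st z)))).
  { unfold cut_oracle. apply rel_if; auto with rel. apply rel_S.
    apply (relb_testbit O u (fun z => p2 (st z) + p2 (st z))); auto with rel. }
  apply (rel_select O (fun z => p1 (p1 (p1 (st z)))) st
   [ _; _; _; _; _; _; _; _; _; _; _; _; _; _ ]); auto 10 with rel.
  repeat (apply Forall_cons; [cbv zeta|]); try apply Forall_nil; auto 20 with rel.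
Qed.

Lemma rel_run_cut O n b u st :
  rel O n -> rel O b -> rel O u -> rel O st ->
  rel O (fun z => run (n z) (cut_oracle (b z) (Nat.testbit (u z))) (st z)).
Proof.
  intros Hn Hb Hu Hs.
  apply rel_ext with (fun z => nat_rect (fun _ => nat) (st z)
    (fun _ r => step (cut_oracle (b z) (Nat.testbit (u z))) r) (n z)).
  - intros z. generalize (cut_oracle (b z) (Nat.testbit (u z))) as orc. intros orc.
    generalize (n z) (st z). clear. induction n as [|n IH]; intros st; [reflexivity|].
    cbn [run nat_rect]. rewrite <- IH. clear IH.
    induction n as [|n IH]; cbn [nat_rect]; congruence.
  - apply (rel_rec O st (fun z _ r => step (cut_oracle (b z) (Nat.testbit (u z))) r)); auto.
    apply (rel_step_cut O (fun w => b (p1 w)) (fun w => u (p1 w)));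
      auto with rel; (apply (rel_comp O b) || apply (rel_comp O u)); auto with rel.
Qed.

(** * Separators of the universal pair *)

(** Here [i] codes a program together with its input, so [out i 0] and [out i 1] are the universal
    pair [K0], [K1]. *)
Definition out (i v : nat) : Prop :=
  exists n, run n no_oracle (pr (pr (p1 i) 0) (p2 i)) = pr 0 v.

Definition separator (z : nat -> bool) : Prop :=
  forall i v, out i v -> v <= 1 -> Nat.b2n (z i) = v.

Definition outputs (orc : nat -> nat) (t c x : nat) (P : nat -> bool) : bool :=
  let r := run t orc (pr (pr c 0) x) in ((p1 r =? 0) && P (p2 r))%bool.

Lemma outputs_spec orc t c x P :
  outputs orc t c x P = true <->
  exists v, run t orc (pr (pr c 0) x) = pr 0 v /\ P v = true.
Proof.
  unfold outputs. rewrite Bool.andb_true_iff, Nat.eqb_eq. split.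
  - intros [H1 H2]. exists (p2 (run t orc (pr (pr c 0) x))). split; [|exact H2].
    rewrite <- (pr_p12 (run t orc (pr (pr c 0) x))) at 1. now rewrite H1.
  - intros (v & -> & H). now rewrite p1_pr, p2_pr.
Qed.

Definition wrong_at (t i : nat) (b : bool) : bool :=
  outputs no_oracle t (p1 i) (p2 i) (fun v => (v <=? 1) && negb (v =? Nat.b2n b))%bool.

Lemma out_eval c x y : eval0 c x y -> out (pr (enc c) x) y.
Proof.
  intros H. destruct (computes_eval _ _ _ _ H) as (n & b & C).
  exists n. rewrite p1_pr, p2_pr. apply C. intros q a _ [].
Qed.

Lemma bool_of_pred (P : nat -> Prop) : exists p : nat -> bool, forall n, p n = true <-> P n.
Proof.
  exists (fun n => if excluded_middle_informative (P n) then true else false).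
  intros n. destruct (excluded_middle_informative (P n)); split; easy.
Qed.

(** [K1] itself is a separator: it is disjoint from [K0] because the machine is deterministic. *)
Lemma separator_exists : exists z, separator z.
Proof.
  destruct (bool_of_pred (fun i => out i 1)) as [z Hz]. exists z.
  intros i v Hv Lv. destruct (z i) eqn:E.
  - apply Hz in E. destruct E as [n E], Hv as [m Hv]. exact (run_det _ _ _ _ _ _ E Hv).
  - destruct v as [|[|v]]; [reflexivity| |lia]. apply Hz in Hv. congruence.
Qed.

Definition char (z : nat -> bool) : nat -> Prop := fun n => z n = true.

Lemma char_graph_char z n v : char_graph (char z) n v <-> v = Nat.b2n (z n).
Proof. unfold char_graph, char. destruct (z n); simpl; intuition congruence. Qed.

Lemma rel_oracle z : relb (char_graph (char z)) z.
Proof. exists COracle. intros x. now apply char_graph_char. Qed.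

Lemma turing_le_char A z : relb (char_graph A) z -> turing_le (char z) A.
Proof.
  intros [c Hc]. exists c. intros n v Hn. apply char_graph_char in Hn. subst v. apply Hc.
Qed.

(** * Computing with binary strings *)

(** Bits are packed with the least significant first. The length is not recorded; it is carried
    separately, or marked by a leading 1 added on top. *)
Definition prefix (U : nat -> bool) (n : nat) : nat :=
  nat_rect (fun _ => nat) 0 (fun m r => r + (if U m then 2 ^ m else 0)) n.

Lemma prefix_lt U n : prefix U n < 2 ^ n.
Proof.
  induction n as [|n IH]; cbn [prefix nat_rect]; [simpl; lia|].
  fold (prefix U n). rewrite Nat.pow_succ_r'. destruct (U n); lia.
Qed.

Lemma testbit_small a n : a < 2 ^ n -> Nat.testbit a n = false.
Proof. intros L. rewrite Nat.testbit_eqb, Nat.div_small; auto. Qed.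

Lemma testbit_add_pow2 a n i (b : bool) :
  a < 2 ^ n ->
  Nat.testbit (a + (if b then 2 ^ n else 0)) i =
  if i <? n then Nat.testbit a i else (b && (i =? n))%bool.
Proof.
  intros L. destruct (Nat.ltb_spec i n) as [H|H], b; rewrite ?Nat.add_0_r; auto.
  - rewrite !Nat.testbit_eqb. replace n with (S (n - S i) + i) by lia.
    rewrite Nat.pow_add_r, Nat.div_add by (apply Nat.pow_nonzero; lia).
    now rewrite Nat.pow_succ_r', Nat.mul_comm, Nat.Div0.mod_add.
  - destruct (Nat.eqb_spec i n) as [->|N].
    + rewrite Nat.testbit_eqb.
      replace (a + 2 ^ n) with (a + 1 * 2 ^ n) by lia.
      rewrite Nat.div_add by (apply Nat.pow_nonzero; lia). now rewrite Nat.div_small.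
    + apply testbit_small. apply Nat.lt_le_trans with (2 ^ S n).
      * rewrite Nat.pow_succ_r'. lia.
      * apply Nat.pow_le_mono_r; lia.
  - apply testbit_small. apply Nat.lt_le_trans with (2 ^ n); [auto|].
    apply Nat.pow_le_mono_r; lia.
Qed.

Lemma testbit_prefix U n i : i < n -> Nat.testbit (prefix U n) i = U i.
Proof.
  induction n as [|n IH]; intros L; [lia|].
  cbn [prefix nat_rect]. fold (prefix U n).
  rewrite testbit_add_pow2 by apply prefix_lt.
  destruct (Nat.ltb_spec i n); [auto|].
  replace i with n by lia. rewrite Nat.eqb_refl. apply Bool.andb_true_r.
Qed.

Lemma rel_prefix O z n : relb O z -> rel O n -> rel O (fun x => prefix z (n x)).
Proof.
  intros Hz Hn.
  apply (rel_rec O (fun _ => 0) (fun _ m r => r + (if z m then 2 ^ m else 0))); auto with rel.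
  apply rel_add; auto with rel. apply rel_if; auto with rel.
  apply (rel_comp O (fun i => Nat.b2n (z i))); auto with rel.
Qed.

(** * Unbounded search *)

Lemma least (P : nat -> bool) :
  (exists n, P n = true) -> exists n, P n = true /\ forall k, k < n -> P k = false.
Proof.
  intros [n H]. revert H. induction n as [n IH] using (well_founded_induction lt_wf).
  intros H. destruct (classic (exists k, k < n /\ P k = true)) as [(k & L & Hk)|N].
  - now apply (IH k).
  - exists n. split; [auto|]. intros k L. apply Bool.not_true_iff_false. eauto.
Qed.

(** The test may fail everywhere on some inputs: halting is claimed only where a least witness
    exists. The test is negated because [CMu] looks for a zero. *)
Lemma eval_search O T :
  relb O T ->
  exists c, forall x s, T (pr x s) = true -> (forall k, k < s -> T (pr x k) = false) ->
  eval O (CMu c) x s.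
Proof.
  intros HT. destruct (relb_neg O T HT) as [c Hc]. exists c. intros x s Hs Hlt. split.
  - specialize (Hc (pr x s)). now rewrite Hs in Hc.
  - intros k Hk. exists 0. specialize (Hc (pr x k)). now rewrite (Hlt k Hk) in Hc.
Qed.

Lemma rel_search O T :
  relb O T -> (forall x, exists y, T (pr x y) = true) ->
  exists m, rel O m /\ forall x, T (pr x (m x)) = true.
Proof.
  intros HT HE.
  pose (m x := constructive_indefinite_description _
    (least (fun y => T (pr x y)) (HE x))).
  exists (fun x => proj1_sig (m x)). split.
  - destruct (eval_search O T HT) as [c Hc]. exists (CMu c). intros x.
    destruct (m x) as [y [Hy Hlt]]. now apply Hc.
  - intros x. now destruct (m x) as [y [Hy Hlt]].
Qed.

Lemma ce_exists T :
  relb (fun _ _ => False) T -> ce (fun n => exists k, T (pr n k) = true).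
Proof.
  intros HT. destruct (relb_neg _ T HT) as [c Hc]. exists (CMu c). intros n. split.
  - intros H. apply least in H. destruct H as (s & Hs & Hlt). exists s. split.
    + specialize (Hc (pr n s)). now rewrite Hs in Hc.
    + intros k Hk. exists 0. specialize (Hc (pr n k)). now rewrite (Hlt k Hk) in Hc.
  - intros (v & H & _). exists v.
    assert (E : Nat.b2n (negb (T (pr n v))) = 0).
    { eapply eval_functional; [|apply Hc|exact H]. easy. }
    now destruct (T (pr n v)).
Qed.

(** * The ceers *)

Lemma relb_outputs O b u t c x P :
  rel O b -> rel O u -> rel O t -> rel O c -> rel O x ->
  relb O (fun w => P (p1 w) (p2 w)) ->
  relb O (fun z => outputs (cut_oracle (b z) (Nat.testbit (u z))) (t z) (c z) (x z) (P z)).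
Proof.
  intros Hb Hu Ht Hc Hx HP. unfold outputs. cbv zeta.
  assert (Hr : rel O (fun z =>
    run (t z) (cut_oracle (b z) (Nat.testbit (u z))) (pr (pr (c z) 0) (x z))))
    by (apply rel_run_cut; auto with rel).
  apply relb_and; [apply relb_eqb; auto with rel|].
  apply (relb_ext O (fun z => P (p1 (pr z (p2 (run (t z) (cut_oracle (b z)
    (Nat.testbit (u z))) (pr (pr (c z) 0) (x z))))))
      (p2 (pr z (p2 (run (t z) (cut_oracle (b z)
    (Nat.testbit (u z))) (pr (pr (c z) 0) (x z)))))))).
  - intros z. now rewrite p1_pr, p2_pr.
  - apply (rel_comp O (fun w => Nat.b2n (P (p1 w) (p2 w)))); auto with rel.
Qed.

Lemma relb_wrong_at O t i b :
  rel O t -> rel O i -> relb O b -> relb O (fun z => wrong_at (t z) (i z) (b z)).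
Proof.
  intros Ht Hi Hb.
  (* Cutting at 0 turns the cut oracle into [no_oracle]. *)
  apply (relb_outputs O (fun _ => 0) (fun _ => 0) t (fun z => p1 (i z)) (fun z => p2 (i z))
    (fun z v => (v <=? 1) && negb (v =? Nat.b2n (b z)))%bool); auto with rel.
  assert (rel O (fun w => Nat.b2n (b (p1 w))))
    by (apply (rel_comp O (fun z => Nat.b2n (b z))); auto with rel).
  auto with rel.
Qed.

Lemma separator_not_wrong z t i : separator z -> wrong_at t i (z i) = false.
Proof.
  intros Hz. apply Bool.not_true_iff_false. intros H.
  apply outputs_spec in H. destruct H as (v & Hv & E).
  apply Bool.andb_true_iff in E. destruct E as [E1 E2].
  apply Nat.leb_le in E1. apply Bool.negb_true_iff, Nat.eqb_neq in E2.
  apply E2. symmetry. apply Hz; [now exists t|auto].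
Qed.

(** Arbitrarily late stages suffice, since a halted run stays halted and an error once visible stays
    visible. *)
Lemma separator_of_not_wrong z :
  (forall i t, exists t', t <= t' /\ wrong_at t' i (z i) = false) -> separator z.
Proof.
  intros Hz i v [t Hv] Lv. destruct (Hz i t) as (t' & L & H).
  destruct (Nat.eq_dec v (Nat.b2n (z i))) as [|N]; [auto|exfalso].
  apply Bool.not_true_iff_false in H. apply H. apply outputs_spec. exists v. split.
  - now apply run_stable with t.
  - apply Nat.leb_le in Lv. apply Nat.eqb_neq in N. now rewrite Lv, N.
Qed.

(* The binary expansion of [w] without its leading 1 is read as a string. *)
Definition bad_at (k w : nat) : bool :=
  exlt k (fun i => (2 ^ S i <=? w) && wrong_at k i (Nat.testbit w i))%bool.

Definition bad (w : nat) : Prop := exists k, bad_at k w = true.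

Definition collapse (w w' : nat) : Prop := w = w' \/ (bad w /\ bad w').

Lemma relb_bad_at O k w : rel O k -> rel O w -> relb O (fun z => bad_at (k z) (w z)).
Proof.
  intros Hk Hw.
  assert (rel O (fun z => k (p1 z))) by (apply (rel_comp O k); auto with rel).
  assert (rel O (fun z => w (p1 z))) by (apply (rel_comp O w); auto with rel).
  apply (relb_exlt O k
    (fun z i => (2 ^ S i <=? w z) && wrong_at (k z) i (Nat.testbit (w z) i))%bool); auto.
  apply relb_and; [apply relb_leb; auto with rel|].
  apply relb_wrong_at; auto with rel.
Qed.

Lemma ceer_collapse : ceer collapse.
Proof.
  split.
  - split.
    + intros x. now left.
    + intros x y [->|[Hx Hy]]; [now left|now right].
    + intros x y z [->|[Hx Hy]] [->|[Hy' Hz]]; [now left| | |]; now right.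
  - pose (T n := ((p1 (p1 n) =? p2 (p1 n)) ||
      (bad_at (p1 (p2 n)) (p1 (p1 n)) && bad_at (p2 (p2 n)) (p2 (p1 n))))%bool).
    assert (HT : relb (fun _ _ => False) T).
    { apply relb_or; [apply relb_eqb|apply relb_and; apply relb_bad_at]; auto with rel. }
    destruct (ce_exists T HT) as [c Hc]. exists c. intros n. rewrite <- Hc.
    change (collapse (p1 n) (p2 n) <-> exists k, T (pr n k) = true).
    unfold T, collapse, bad. clear. split.
    + intros [E|[[k Hk] [k' Hk']]].
      * exists 0. rewrite p1_pr. apply Nat.eqb_eq in E. now rewrite E.
      * exists (pr k k'). rewrite !p2_pr, !p1_pr, Hk, Hk'. apply Bool.orb_true_r.
    + intros [k H]. rewrite p1_pr, p2_pr in H. apply Bool.orb_true_iff in H.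
      destruct H as [H|H]; [left; now apply Nat.eqb_eq|right].
      apply Bool.andb_true_iff in H. destruct H. eauto.
Qed.

Lemma ceer_eq : ceer eq.
Proof.
  split; [apply eq_equivalence|].
  assert (HT : relb (fun _ _ => False) (fun n => p1 (p1 n) =? p2 (p1 n)))
    by (apply relb_eqb; auto with rel).
  destruct (ce_exists _ HT) as [c Hc]. exists c. intros n. rewrite <- Hc.
  change (p1 n = p2 n <-> exists k, (p1 (p1 (pr n k)) =? p2 (p1 (pr n k))) = true). split.
  - intros E. exists 0. rewrite p1_pr. now apply Nat.eqb_eq.
  - intros [k H]. rewrite p1_pr in H. now apply Nat.eqb_eq.
Qed.

Lemma injective_unbounded (f : nat -> nat) N M :
  (forall x y, f x = f y -> x = y) -> exists m, N <= m /\ M <= f m.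
Proof.
  intros Hf. apply NNPP. intros H.
  (* Pigeonhole: otherwise the [S M] arguments from [N] on would all be mapped below [M]. *)
  assert (L : length (map f (seq N (S M))) <= length (seq 0 M)).
  { apply NoDup_incl_length.
    - apply Injective_map_NoDup; [exact Hf|apply seq_NoDup].
    - intros y Hy. apply in_map_iff in Hy. destruct Hy as (m & <- & Hm).
      apply in_seq in Hm. apply in_seq. split; [lia|].
      apply Nat.nle_gt. intros L. apply H. exists m. lia. }
  rewrite length_map, !length_seq in L. lia.
Qed.

Lemma transversal_infinitely_many_classes S f :
  Equivalence S -> (forall x y : nat, S (f x) (f y) -> x = y) -> infinitely_many_classes S.
Proof.
  intros HS Hf [l Hl].
  assert (H : forall x, exists n,
    n < length l /\ forall y, nth n l (fun _ => False) y <-> S (f x) y).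
  { intros x. destruct (Hl (f x)) as (C & HC & E).
    destruct (In_nth l C (fun _ => False) HC) as (n & L & <-). now exists n. }
  (* [g x] is the position in [l] of the class of [f x]. It is injective, hence cannot stay below
     [length l]. *)
  pose (g x := proj1_sig (constructive_indefinite_description _ (H x))).
  assert (Hg : forall x, g x < length l /\
    forall y, nth (g x) l (fun _ => False) y <-> S (f x) y)
    by (intros x; exact (proj2_sig (constructive_indefinite_description _ (H x)))).
  destruct (injective_unbounded g 0 (length l)) as (m & _ & Lm).
  - intros x y E. apply Hf. apply (Hg x). rewrite E. apply (Hg y). reflexivity.
  - destruct (Hg m). lia.
Qed.

(** * The spectrum consists of the degrees computing separators *)

Lemma separator_reduction z :
  separator z ->
  exists f, rel (char_graph (char z)) f /\ forall x y, x = y <-> collapse (f x) (f y).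
Proof.
  (* The term [2 ^ n] is the leading 1, so [f n] codes the string of the first [n] bits of [z],
     which is never bad. *)
  intros Hz. pose (f n := prefix z n + 2 ^ n). exists f. split.
  { apply rel_add; auto with rel. apply rel_prefix; auto with rel. apply rel_oracle. }
  assert (Hf : forall n, ~ bad (f n)).
  { intros n [k H]. apply exlt_spec in H. destruct H as (i & _ & H).
    apply Bool.andb_true_iff in H. destruct H as [L H]. apply Nat.leb_le in L.
    pose proof (prefix_lt z n) as Lp.
    assert (Li : i < n).
    { apply Nat.nle_gt. intros Ln.
      pose proof (Nat.pow_le_mono_r 2 n i ltac:(lia) Ln).
      rewrite Nat.pow_succ_r' in L. unfold f in L. lia. }
    unfold f in H. rewrite (testbit_add_pow2 _ n i true Lp) in H.
    apply Nat.ltb_lt in Li as Li'. rewrite Li', testbit_prefix in H by exact Li.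
    rewrite separator_not_wrong in H; easy. }
  assert (Hmono : forall x y, x < y -> f x < f y).
  { intros x y L. pose proof (prefix_lt z x).
    pose proof (Nat.pow_le_mono_r 2 (S x) y ltac:(lia) L) as Lp.
    rewrite Nat.pow_succ_r' in Lp. unfold f. lia. }
  intros x y. split.
  - intros ->. now left.
  - intros [E|[Hx _]]; [|now apply Hf in Hx].
    destruct (Nat.lt_trichotomy x y) as [L|[L|L]]; [|exact L|];
      apply Hmono in L; lia.
Qed.

(** The bad numbers form one class, so [f] hits them at most once, and a fixed [N] lies beyond that
    argument. Past [N] injectivity gives values of [f] with more than [i] bits; bit [i] of any of
    these is never refuted. *)
Lemma reduction_separator O f :
  rel O f -> (forall x y, x = y <-> collapse (f x) (f y)) ->
  exists z, separator z /\ relb O z.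
Proof.
  intros Hf Hred.
  assert (HN : exists N, forall m, N <= m -> ~ bad (f m)).
  { destruct (classic (exists m, bad (f m))) as [[m0 Hm0]|H].
    - exists (S m0). intros m L Hm.
      assert (m = m0) by (apply Hred; right; auto). lia.
    - exists 0. eauto. }
  destruct HN as [N HN].
  destruct (rel_search O (fun w => (N <=? p2 w) && (2 ^ S (p1 w) <=? f (p2 w)))%bool)
    as (m & Hm & Hspec).
  { apply relb_and; apply relb_leb; auto with rel.
    apply (rel_comp O f); auto with rel. }
  { intros i. destruct (injective_unbounded f N (2 ^ S i)) as (m & L & L').
    - intros x y E. apply Hred. now left.
    - exists m. rewrite p1_pr, p2_pr. apply Nat.leb_le in L, L'. now rewrite L, L'. }
  exists (fun i => Nat.testbit (f (m i)) i). split.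
  (* The stage must exceed [i] because [bad_at] inspects only positions below its stage. *)
  - apply separator_of_not_wrong. intros i t. exists (S i + t). split; [lia|].
    specialize (Hspec i). rewrite p1_pr, p2_pr in Hspec.
    apply Bool.andb_true_iff in Hspec. destruct Hspec as [L L'].
    apply Bool.not_true_iff_false. intros W. apply (HN (m i)); [now apply Nat.leb_le|].
    exists (S i + t). apply exlt_spec. exists i. split; [lia|]. now rewrite L', W.
  - apply relb_testbit; auto with rel. now apply (rel_comp O f).
Qed.

(** * No separator has minimal degree *)

(* [U] is viewed as the join of a separator (the even bits) with a set (the odd bits) that
   is diagonally noncomputable relative to it. *)
Definition violated_at (t : nat) (U : nat -> bool) (i : nat) : bool :=
  (wrong_at t i (U (i + i)) ||
   outputs (cut_oracle t U) t i i (fun v => v =? Nat.b2n (U (S (i + i)))))%bool.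

(** Collecting all stages below [s] makes this monotone in [s] at once, although [violated_at]
    changes its oracle cut with [t]. *)
Definition violated (s : nat) (U : nat -> bool) : bool :=
  exlt s (fun t => exlt t (violated_at t U)).

(* At stage [s] every extension of the string of the first [n] bits of [w] is violated.  Only
   the bits below [s + s] of an oracle matter, so testing finitely many [u] suffices. *)
Definition dead (s n w : nat) : bool :=
  negb (exlt (2 ^ (s + s + n)) (fun u => negb
    (exlt n (fun i => xorb (Nat.testbit u i) (Nat.testbit w i)) ||
     violated s (Nat.testbit u)))%bool).

Lemma violated_mono s s' U : s <= s' -> violated s U = true -> violated s' U = true.
Proof.
  intros L H. apply exlt_spec in H. destruct H as (t & Lt & H).
  apply exlt_spec. exists t. split; [lia|auto].
Qed.

Lemma exlt_ext n P Q : (forall k, k < n -> P k = Q k) -> exlt n P = exlt n Q.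
Proof.
  induction n as [|n IH]; intros E; [reflexivity|].
  unfold exlt in *. cbn [nat_rect]. rewrite (E n) by lia. f_equal. apply IH. auto with arith.
Qed.

(** With [i < t < s], the bits read are [i + i], [S (i + i)] and [q + q] for [q < t], all below
    [s + s]. *)
Lemma violated_ext s U U' :
  (forall i, i < s + s -> U i = U' i) -> violated s U = violated s U'.
Proof.
  intros E. apply exlt_ext. intros t Lt. apply exlt_ext. intros i Li.
  unfold violated_at, outputs.
  rewrite (E (i + i)), (E (S (i + i))) by lia.
  rewrite (run_ext (cut_oracle t U) (cut_oracle t U')); [reflexivity|].
  intros q. unfold cut_oracle. destruct (Nat.ltb_spec q t); [|auto].
  now rewrite E by lia.
Qed.

Lemma dead_violated s n w U :
  dead s n w = true -> (forall i, i < n -> U i = Nat.testbit w i) -> violated s U = true.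
Proof.
  intros H E. apply Bool.negb_true_iff, Bool.not_true_iff_false in H.
  (* The length [s + s + n] covers both the [n] given bits and the bits on which violation at stage
     [s] depends. *)
  apply NNPP. intros NV. apply H. apply exlt_spec. exists (prefix U (s + s + n)).
  split; [apply prefix_lt|]. apply Bool.negb_true_iff, Bool.orb_false_iff. split.
  - apply Bool.not_true_iff_false. intros X. apply exlt_spec in X.
    destruct X as (i & Li & X). rewrite testbit_prefix, E in X by lia.
    now destruct (Nat.testbit w i).
  - apply Bool.not_true_iff_false. intros V. apply NV. rewrite <- V.
    apply violated_ext. intros i Li. now rewrite testbit_prefix by lia.
Qed.

Lemma dead_intro s n w :
  (forall U, (forall i, i < n -> U i = Nat.testbit w i) -> violated s U = true) ->
  dead s n w = true.
Proof.
  intros H. apply Bool.negb_true_iff, Bool.not_true_iff_false. intros X.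
  apply exlt_spec in X. destruct X as (u & _ & X).
  apply Bool.negb_true_iff, Bool.orb_false_iff in X. destruct X as [X V].
  rewrite H in V; [discriminate|]. intros i Li.
  apply Bool.not_true_iff_false in X. rewrite exlt_spec in X.
  apply Bool.xorb_eq. apply Bool.not_true_iff_false. eauto.
Qed.

(** A string of length [s + s] already decides violation at stage [s], so being not dead passes from
    the string to [U]. *)
Lemma not_dead_not_violated s U :
  dead s (s + s) (prefix U (s + s)) = false -> violated s U = false.
Proof.
  intros H. apply Bool.not_true_iff_false. intros V.
  apply Bool.not_true_iff_false in H. apply H, dead_intro.
  intros U' E. rewrite <- V. apply violated_ext. intros i Li.
  now rewrite E, testbit_prefix.
Qed.

Lemma relb_dead O s n w :
  rel O s -> rel O n -> rel O w -> relb O (fun z => dead (s z) (n z) (w z)).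
Proof.
  intros Hs Hn Hw. apply relb_neg.
  apply (relb_exlt O (fun z => 2 ^ (s z + s z + n z)) (fun z u => negb
    (exlt (n z) (fun i => xorb (Nat.testbit u i) (Nat.testbit (w z) i)) ||
     violated (s z) (Nat.testbit u)))%bool); auto with rel.
  assert (rel O (fun z => s (p1 z))) by (apply (rel_comp O s); auto with rel).
  assert (rel O (fun z => n (p1 z))) by (apply (rel_comp O n); auto with rel).
  assert (rel O (fun z => w (p1 (p1 z)))) by (apply (rel_comp O w); auto with rel).
  apply relb_neg, relb_or.
  - apply (relb_exlt O (fun z => n (p1 z))
      (fun z i => xorb (Nat.testbit (p2 z) i) (Nat.testbit (w (p1 z)) i)));
      auto with rel.
  - apply (relb_exlt O (fun z => s (p1 z))
      (fun z t => exlt t (violated_at t (Nat.testbit (p2 z))))); auto with rel.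
    apply (relb_exlt O (fun z => p2 z)
      (fun z i => violated_at (p2 z) (Nat.testbit (p2 (p1 z))) i)); auto with rel.
    apply relb_or.
    + apply relb_wrong_at; auto with rel.
    + apply (relb_outputs O (fun z => p2 (p1 z)) (fun z => p2 (p1 (p1 z)))
        (fun z => p2 (p1 z)) (fun z => p2 z) (fun z => p2 z)
        (fun z v => v =? Nat.b2n (Nat.testbit (p2 (p1 (p1 z))) (S (p2 z + p2 z)))));
        auto 10 with rel.
      apply relb_eqb; auto with rel.
      apply relb_testbit; auto 10 with rel.
Qed.

(** This is the nonemptiness of the class. Join any separator [x] with the set [y] of those [i] for
    which program [i] with oracle [x] outputs 0 on [i]; such an output then differs from the bit of
    [y], which is 1, and an output 1 differs from the bit 0. *)
Lemma unviolated_exists : exists U, forall s, violated s U = false.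
Proof.
  destruct separator_exists as [x Hx].
  destruct (bool_of_pred (fun i => exists n, run n (set_oracle x) (pr (pr i 0) i) = pr 0 0))
    as [y Hy].
  pose (U i := if Nat.even i then x (Nat.div2 i) else y (Nat.div2 i)).
  assert (Ux : forall i, U (i + i) = x i).
  { intros i. unfold U. replace (i + i) with (2 * i) by lia.
    now rewrite Nat.even_even, Nat.div2_double. }
  assert (Uy : forall i, U (S (i + i)) = y i).
  { intros i. unfold U. replace (S (i + i)) with (S (2 * i)) by lia.
    rewrite Nat.even_succ, Nat.odd_even. now rewrite Nat.div2_succ_double. }
  exists U. intros s. apply Bool.not_true_iff_false. intros V.
  apply exlt_spec in V. destruct V as (t & _ & V).
  apply exlt_spec in V. destruct V as (i & _ & V).
  unfold violated_at in V. rewrite Ux, Uy in V.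
  rewrite separator_not_wrong in V by exact Hx. cbn [orb] in V.
  apply outputs_spec in V. destruct V as (v & Hv & E). apply Nat.eqb_eq in E.
  (* The cut oracle answers as [x] does where it answers at all, so the halting run carries over to
     the full oracle. *)
  apply (run_mono _ (set_oracle x)) in Hv.
  2:{ intros q a. unfold cut_oracle, set_oracle. rewrite Ux. now destruct (q <? t). }
  destruct (y i) eqn:Yi.
  - apply Hy in Yi. destruct Yi as [n Hn].
    pose proof (run_det _ _ _ _ _ _ Hn Hv). simpl in E. lia.
  - simpl in E. subst v. enough (y i = true) by congruence. apply Hy. eauto.
Qed.

Lemma unviolated_separator U :
  (forall s, violated s U = false) -> separator (fun i => U (i + i)).
Proof.
  intros H. apply separator_of_not_wrong. intros i t. exists (S i + t). split; [lia|].
  apply Bool.not_true_iff_false. intros W.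
  specialize (H (S (S i + t))). apply Bool.not_true_iff_false in H. apply H.
  apply exlt_spec. exists (S i + t). split; [lia|].
  apply exlt_spec. exists i. split; [lia|]. unfold violated_at. now rewrite W.
Qed.

(** A reduction [c], run on its own code, would output the odd bit at that code, which is a diagonal
    violation. *)
Lemma unviolated_not_turing_le U :
  (forall s, violated s U = false) ->
  ~ turing_le (char (fun i => U (S (i + i)))) (char (fun i => U (i + i))).
Proof.
  intros H [c Hc]. set (x := fun i => U (i + i)) in *.
  specialize (Hc (enc c) _ (proj2 (char_graph_char _ _ _) eq_refl)). cbv beta in Hc.
  destruct (computes_eval _ _ _ _ Hc) as (n & b & C).
  (* The stage exceeds the diagonal index, the running time and every query made. *)
  set (t := S (enc c) + n + b).
  specialize (H (S t)). apply Bool.not_true_iff_false in H. apply H.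
  apply exlt_spec. exists t. split; [lia|].
  apply exlt_spec. exists (enc c). split; [lia|].
  apply Bool.orb_true_iff. right. apply outputs_spec.
  eexists. split; [|apply Nat.eqb_refl].
  apply run_stable with n; [lia|]. apply C. intros q a L A.
  apply char_graph_char in A. subst a. unfold cut_oracle.
  destruct (Nat.ltb_spec q t); [reflexivity|lia].
Qed.

(** [U] follows the advice of [z] on the outputs of a program that looks for a dead child. If
    neither child ever dies, the program diverges and either answer is good; otherwise the separator
    must give its output. *)
Lemma separator_unviolated z :
  separator z ->
  exists U, relb (char_graph (char z)) U /\ forall s, violated s U = false.
Proof.
  intros Hz.
  (* On input [pr n w], find the first stage at which one of the two children of the string
     [w] of length [n] is dead, and answer with the direction of the other child. *)
  assert (Hc : exists c, forall n w s,
    (dead s (S n) w || dead s (S n) (w + 2 ^ n) = true)%bool ->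
    (forall k, k < s -> (dead k (S n) w || dead k (S n) (w + 2 ^ n) = false)%bool) ->
    eval0 c (pr n w) (Nat.b2n (dead s (S n) w))).
  { destruct (eval_search (fun _ _ => False)
      (fun r => dead (p2 r) (S (p1 (p1 r))) (p2 (p1 r)) ||
        dead (p2 r) (S (p1 (p1 r))) (p2 (p1 r) + 2 ^ p1 (p1 r)))%bool) as [c Hc].
    { apply relb_or; apply relb_dead; auto 10 with rel. }
    destruct (relb_dead (fun _ _ => False) p2 (fun r => S (p1 (p1 r))) (fun r => p2 (p1 r)))
      as [d Hd]; auto with rel.
    exists (CComp d (CPair (CPair CFst CSnd) (CMu c))). intros n w s Hs Hlt.
    exists (pr (pr n w) s). split.
    - apply eval_pair; [apply eval_id|apply Hc].
      + now rewrite !p1_pr, !p2_pr.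
      + intros k Hk. rewrite !p1_pr, !p2_pr. auto.
    - specialize (Hd (pr (pr n w) s)). cbv beta in Hd.
      now rewrite !p1_pr, !p2_pr in Hd. }
  destruct Hc as [c Hc].
  (* [rho n] is the string built so far, as a number, so that it is obtained from [z] by primitive
     recursion; [U] consists of the directions taken. *)
  pose (rho := nat_rect (fun _ => nat) 0
    (fun n w => w + (if z (pr (enc c) (pr n w)) then 2 ^ n else 0))).
  pose (U n := z (pr (enc c) (pr n (rho n)))).
  assert (Hrho : forall n, rho n = prefix U n).
  { induction n as [|n IH]; [reflexivity|].
    cbn [rho prefix nat_rect]. fold (rho n) (prefix U n). now rewrite <- IH. }
  exists U. split.
  { apply (rel_comp _ (fun i => Nat.b2n (z i))); [apply rel_oracle|].
    apply rel_pr; auto with rel. apply rel_pr; auto with rel.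
    apply (rel_rec _ (fun _ => 0)
      (fun _ n w => w + (if z (pr (enc c) (pr n w)) then 2 ^ n else 0))); auto with rel.
    apply rel_add; auto with rel. apply rel_if; auto with rel.
    apply (rel_comp _ (fun i => Nat.b2n (z i))); [apply rel_oracle|auto with rel]. }
  assert (Halive : forall n s, dead s n (prefix U n) = false).
  { induction n as [|n IH]; intros s.
    - destruct unviolated_exists as [V HV].
      apply Bool.not_true_iff_false. intros D.
      assert (violated s V = true) by (eapply dead_violated; [exact D|lia]).
      now rewrite HV in *.
    - set (w := prefix U n) in *.
      assert (Hw : w < 2 ^ n) by apply prefix_lt.
      (* If both children died, then at the sum of the two stages every extension of [w] would be
         violated, and [w] would be dead. *)
      assert (Hnot : forall s s', dead s (S n) w = true ->
        dead s' (S n) (w + 2 ^ n) = true -> False).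
      { intros r r' D D'. set (m := r + r').
        enough (dead m n w = true) by now rewrite IH in *.
        apply dead_intro. intros V E.
        assert (EV : forall i, i < S n ->
          V i = Nat.testbit (w + (if V n then 2 ^ n else 0)) i).
        { intros i Li. rewrite testbit_add_pow2 by exact Hw.
          destruct (Nat.ltb_spec i n); [auto|].
          replace i with n by lia. now rewrite Nat.eqb_refl, Bool.andb_true_r. }
        destruct (V n); [apply (violated_mono r')|apply (violated_mono r)]; try lia.
        - exact (dead_violated _ _ _ _ D' EV).
        - rewrite Nat.add_0_r in EV. exact (dead_violated _ _ _ _ D EV). }
      cbn [prefix nat_rect]. fold (prefix U n). fold w.
      apply Bool.not_true_iff_false. intros D.
      assert (Hs : exists s0, (dead s0 (S n) w || dead s0 (S n) (w + 2 ^ n) = true)%bool).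
      { exists s. destruct (U n); [|rewrite Nat.add_0_r in D]; rewrite D;
          auto using Bool.orb_true_r. }
      apply (least (fun s => dead s (S n) w || dead s (S n) (w + 2 ^ n))%bool) in Hs.
      destruct Hs as (s0 & Hs & Hlt).
      (* The direction taken is thus the output of the program, which avoids a child dead at stage
         [s0]. As the chosen child is dead by [D], both children are dead. *)
      pose proof (Hz _ _ (out_eval _ _ _ (Hc n w s0 Hs Hlt))) as HU.
      replace (z (pr (enc c) (pr n w))) with (U n) in HU
        by (unfold U; now rewrite Hrho).
      destruct (U n), (dead s0 (S n) w) eqn:D0; simpl in HU.
      + exact (Hnot _ _ D0 D).
      + specialize (HU (Nat.le_0_l _)). discriminate HU.
      + specialize (HU (le_n _)). discriminate HU.
      + rewrite Nat.add_0_r in D. exact (Hnot _ _ D Hs). }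
  intros s. apply not_dead_not_violated, Halive.
Qed.

(** * The spectrum has no basis *)

Definition degree_of (A : nat -> Prop) : degree :=
  Degree (turing_equiv A) (ex_intro _ A (fun B => iff_refl _)).

Lemma degree_of_mem A : degree_of A A.
Proof. split; apply turing_le_refl. Qed.

Lemma degree_mem_le (d : degree) A B : d A -> d B -> turing_le A B.
Proof.
  destruct (deg_class d) as [C HC]. intros HA HB. apply HC in HA, HB.
  exact (turing_le_trans _ _ _ (proj2 HA) (proj1 HB)).
Qed.

Lemma deg_le_mem (d e : degree) A B : deg_le d e -> d A -> e B -> turing_le A B.
Proof.
  intros (A' & B' & HA' & HB' & L) HA HB.
  apply turing_le_trans with A'; [now apply (degree_mem_le d)|].
  apply turing_le_trans with B'; [exact L|now apply (degree_mem_le e)].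
Qed.

Lemma reducible_separator z : separator z -> DgSp eq collapse (degree_of (char z)).
Proof.
  intros Hz. destruct (separator_reduction z Hz) as (f & Hf & E).
  exists f. split; [|exact E]. exists (char z). split; [apply degree_of_mem|exact Hf].
Qed.

Lemma DgSp_no_basis : ~ exists B, is_basis B (DgSp eq collapse).
Proof.
  intros (B & Hinc & HB).
  destruct separator_exists as [z0 Hz0].
  destruct (proj1 (HB _) (reducible_separator z0 Hz0)) as (b & Bb & _).
  (* A basis element lies above itself, hence belongs to the spectrum. *)
  assert (Hb : DgSp eq collapse b).
  { apply HB. exists b. split; [exact Bb|]. destruct (deg_class b) as [A HA].
    exists A, A. assert (b A) by (apply HA; split; apply turing_le_refl).
    auto using turing_le_refl. }
  destruct Hb as (f & (C & HC & Hf) & E).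
  destruct (reduction_separator _ f Hf E) as (z & Hz & HzC).
  destruct (separator_unviolated z Hz) as (U & HU & HV).
  pose (x i := U (i + i)). pose (y i := U (S (i + i))).
  assert (HUC : relb (char_graph C) x /\ relb (char_graph C) y).
  { apply turing_le_char in HzC. pose proof (computable_in_trans _ _ _ HU HzC) as HU'.
    split; apply (rel_comp _ (fun i => Nat.b2n (U i))); auto with rel. }
  destruct HUC as [HxC HyC].
  assert (Hx : separator x) by now apply unviolated_separator.
  destruct (proj1 (HB _) (reducible_separator x Hx)) as (b' & Bb' & Lb').
  (* [b'] lies below the degree of [x], which lies below [b]; incomparability leaves only
     equality. *)
  assert (Eb : b = b').
  { apply NNPP. intros N. destruct (Hinc b b' Bb Bb' N) as [_ N']. apply N'.
    destruct Lb' as (A & X & HA & HX & L). exists A, C. repeat split; auto.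
    apply turing_le_trans with (char x);
      [exact (turing_le_trans _ _ _ L (proj2 HX))|now apply turing_le_char]. }
  subst b'. apply (unviolated_not_turing_le U HV). fold x y.
  (* Now [y] is computable from [C], and [C] from [x] because [b] lies below the degree of [x]. *)
  apply turing_le_trans with C; [now apply turing_le_char|].
  exact (deg_le_mem _ _ _ _ Lb' HC (degree_of_mem _)).
Qed.

Theorem theorem4p3 :
  exists R S : nat -> nat -> Prop,
    ceer R /\ ceer S /\
    infinitely_many_classes R /\ infinitely_many_classes S /\
    ~ (exists B : degree -> Prop, is_basis B (DgSp R S)).
Proof.
  exists eq, collapse.
  split; [exact ceer_eq|]. split; [exact ceer_collapse|]. split; [|split].
  - apply transversal_infinitely_many_classes with (fun n => n); [apply ceer_eq|auto].
  - destruct separator_exists as [z Hz]. destruct (separator_reduction z Hz) as (f & _ & E).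
    apply transversal_infinitely_many_classes with f; [apply ceer_collapse|].
    intros x y. apply E.
  - exact DgSp_no_basis.
Qed.
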